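(* Let $n,r\ge 0$ be integers and $k\in\mathbb{Z}$. Then, as polynomials in $x$, $$A_{n}^{(r,k)}(x)=\sum_{j=0}^{n}\left\{ \sum_{m=j}^{n}\sum_{l=0}^{m-j}\frac{\binom{m}{l}\binom{m-l}{j}}{\binom{m-l-j+r}{r}(l+1)^{k}}\,S_1(n,m)\,S_2(m-l-j+r,r)\right\}(-x)^{j}.$$
   Context: All generating functions are formal power series in $t$. For $k\in\mathbb{Z}$, put $\mathrm{Lif}_k(t)=\sum_{n\ge 0}\frac{t^n}{n!(n+1)^k}$. For $r,k\in\mathbb{Z}$, the polynomials $A_n^{(r,k)}(x)\in\mathbb{C}[x]$ are defined by $$\left(\frac{t}{\log(1+t)}\right)^{r}\frac{\mathrm{Lif}_k(\log(1+t))}{(1+t)^{x}}=\sum_{n\ge 0}A_n^{(r,k)}(x)\frac{t^n}{n!}.$$ $S_1(n,m)$ is the (signed) Stirling number of the first kind: $x(x-1)\cdots(x-n+1)=\sum_{m=0}^n S_1(n,m)x^m$. $S_2(n,m)$ is the Stirling number of the second kind: $(e^t-1)^m=m!\sum_{n\ge m}S_2(n,m)\frac{t^n}{n!}$. *)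

(* Defs.v *)
From HB Require Import structures.
From mathcomp Require Import all_boot all_order all_algebra.
From mathcomp Require Import zify.
From mathcomp Require Import boolp reals complex.

Set Implicit Arguments.
Unset Strict Implicit.
Unset Printing Implicit Defensive.

Import Order.TTheory GRing.Theory Num.Theory.
Local Open Scope ring_scope.

(* Formal power series in one variable t; [f n] is the coefficient of t^n. The
   record wrapper keeps the Cauchy product apart from the pointwise product
   on functions. *)
Record fps (R : Type) := Fps { fps_coef :> nat -> R }.

HB.instance Definition _ (R : Type) := gen_eqMixin (fps R).
HB.instance Definition _ (R : Type) := gen_choiceMixin (fps R).

Lemma fpsP (R : Type) (f g : fps R) : f =1 g -> f = g.
Proof. by case: f g => [f] [g] /= /funext ->. Qed.

Definition fps_zero (R : zmodType) : fps R := Fps (fun=> 0).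
Definition fps_opp (R : zmodType) (f : fps R) : fps R := Fps (fun n => - f n).
Definition fps_add (R : zmodType) (f g : fps R) : fps R :=
  Fps (fun n => f n + g n).

Lemma fps_addA (R : zmodType) : associative (@fps_add R).
Proof. by move=> f g h; apply: fpsP => n /=; rewrite addrA. Qed.
Lemma fps_addC (R : zmodType) : commutative (@fps_add R).
Proof. by move=> f g; apply: fpsP => n /=; rewrite addrC. Qed.
Lemma fps_add0 (R : zmodType) : left_id (fps_zero R) (@fps_add R).
Proof. by move=> f; apply: fpsP => n /=; rewrite add0r. Qed.
Lemma fps_addN (R : zmodType) :
  left_inverse (fps_zero R) (@fps_opp R) (@fps_add R).
Proof. by move=> f; apply: fpsP => n /=; rewrite addNr. Qed.

HB.instance Definition _ (R : zmodType) := GRing.isZmodule.Build (fps R)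
  (@fps_addA R) (@fps_addC R) (@fps_add0 R) (@fps_addN R).

Definition fps_one (R : nzRingType) : fps R := Fps (fun n => (n == 0)%:R).
Definition fps_mul (R : nzRingType) (f g : fps R) : fps R :=
  Fps (fun n => \sum_(i < n.+1) f i * g (n - i)%N).

Definition fps_trunc (R : nzRingType) (N : nat) (f : fps R) : {poly R} :=
  \poly_(i < N) f i.

Lemma fps_mul_trunc (R : nzRingType) N (f g : fps R) n : (n < N)%N ->
  fps_mul f g n = (fps_trunc N f * fps_trunc N g)`_n.
Proof.
move=> ltnN; rewrite coefM; apply: eq_bigr => i _.
have lein : (i <= n)%N by rewrite -ltnS.
by rewrite !coef_poly (leq_ltn_trans lein ltnN)
           (leq_ltn_trans (leq_subr i n) ltnN).
Qed.

Lemma fps_mulA (R : nzRingType) : associative (@fps_mul R).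
Proof.
move=> f g h; apply: fpsP => n.
transitivity ((fps_trunc n.+1 f * (fps_trunc n.+1 g * fps_trunc n.+1 h))`_n).
  rewrite coefM; apply: eq_bigr => i _.
  by rewrite coef_poly ltn_ord (@fps_mul_trunc _ n.+1) // ltnS leq_subr.
rewrite mulrA coefM; apply: eq_bigr => i _.
by rewrite coef_poly ltnS leq_subr (@fps_mul_trunc _ n.+1) ?ltn_ord.
Qed.

Lemma fps_mulC (R : comNzRingType) : commutative (@fps_mul R).
Proof.
by move=> f g; apply: fpsP => n; rewrite !(@fps_mul_trunc _ n.+1) // mulrC.
Qed.

Lemma fps_mul1 (R : nzRingType) : left_id (fps_one R) (@fps_mul R).
Proof.
move=> f; apply: fpsP => n /=.
rewrite big_ord_recl /= mul1r subn0 big1 ?addr0 // => i _.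
by rewrite /= mul0r.
Qed.

Lemma fps_mulDl (R : nzRingType) :
  left_distributive (@fps_mul R) (@fps_add R).
Proof.
move=> f g h; apply: fpsP => n /=.
by rewrite -big_split; apply: eq_bigr => i _; rewrite mulrDl.
Qed.

Lemma fps_one_neq0 (R : nzRingType) : fps_one R != fps_zero R.
Proof.
by apply/eqP => /(congr1 (fun f : fps R => f 0)) /eqP; rewrite oner_eq0.
Qed.

HB.instance Definition _ (R : comNzRingType) :=
  GRing.Zmodule_isComNzRing.Build (fps R) (@fps_mulA R) (@fps_mulC R)
    (@fps_mul1 R) (@fps_mulDl R) (fps_one_neq0 R).

(* A series is invertible iff its constant coefficient is. The inverse is the
   geometric series f^-1 = f(0)^-1 * sum_k (1 - f(0)^-1 f)^k, whose terms with
   k > n do not contribute to the coefficient of t^n. *)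
Definition fps_unit (R : comUnitRingType) : {pred fps R} :=
  fun f => f 0 \is a GRing.unit.

Definition fps_inv (R : comUnitRingType) (f : fps R) : fps R :=
  if f \in @fps_unit R then
    let u : fps R := 1 - Fps (fun n => (f 0)^-1 * f n) in
    Fps (fun n => (f 0)^-1 * \sum_(k < n.+1) (u ^+ k) n)
  else f.

Lemma fps_coefM (R : comNzRingType) (f g : fps R) n :
  (f * g) n = \sum_(i < n.+1) f i * g (n - i)%N.
Proof. by []. Qed.

Lemma fps_coefD (R : zmodType) (f g : fps R) n : (f + g) n = f n + g n.
Proof. by []. Qed.

Lemma fps_coefN (R : zmodType) (f : fps R) n : (- f) n = - f n.
Proof. by []. Qed.

Lemma fps_coef1 (R : comNzRingType) n : (1 : fps R) n = (n == 0)%:R.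
Proof. by []. Qed.

Lemma fps_coef_sum (R : zmodType) (I : Type) (s : seq I) (P : pred I)
    (F : I -> fps R) n :
  (\sum_(i <- s | P i) F i) n = \sum_(i <- s | P i) F i n.
Proof. by apply: (big_morph (fun f : fps R => f n)). Qed.

Lemma fps_coef_exp_small (R : comNzRingType) (u : fps R) k n :
  u 0 = 0 -> (n < k)%N -> (u ^+ k) n = 0.
Proof.
move=> u0; elim: k n => // k IHk n ltnk.
rewrite exprS fps_coefM big_ord_recl u0 mul0r add0r big1 // => i _.
rewrite IHk ?mulr0 //= /bump /= add1n.
by have := ltn_ord i; case: n ltnk i => [|n] ltnk [i /=]//; lia.
Qed.

Lemma fps_mulVr (R : comUnitRingType) :
  {in @fps_unit R, left_inverse 1 (@fps_inv R) *%R}.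
Proof.
move=> f uf; rewrite /fps_inv uf.
set g := Fps (fun n => (f 0)^-1 * f n); set u := 1 - g.
have u0 : u 0 = 0 by rewrite fps_coefD fps_coefN fps_coef1 /= mulVr ?subrr.
have -> : Fps (fun n => (f 0)^-1 * \sum_(k < n.+1) (u ^+ k) n) * f
        = Fps (fun n => \sum_(k < n.+1) (u ^+ k) n) * g.
  apply: fpsP => n; rewrite !fps_coefM; apply: eq_bigr => i _ /=.
  by rewrite -mulrA mulrCA.
apply: fpsP => n.
transitivity (((\sum_(k < n.+1) u ^+ k) * g) n).
  rewrite !fps_coefM; apply: eq_bigr => i _ /=; congr (_ * _).
  rewrite fps_coef_sum; have: (i <= n)%N by rewrite -ltnS.
  move: (nat_of_ord i) => m /subnKC <-; move: (n - m)%N => d.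
  rewrite -addSn big_split_ord /= [X in _ + X]big1 ?addr0 // => j _.
  by rewrite fps_coef_exp_small //= ltnS leq_addr.
have -> : g = 1 - u by rewrite /u opprB addrC subrK.
rewrite mulrC -opprB mulNr -subrX1 opprB fps_coefD fps_coefN.
by rewrite (fps_coef_exp_small u0) // subr0.
Qed.

Lemma fps_unitPl (R : comUnitRingType) (f g : fps R) :
  g * f = 1 -> @fps_unit R f.
Proof.
move=> /(congr1 (fun h : fps R => h 0)).
rewrite fps_coefM big_ord_recl big_ord0 addr0 subn0 fps_coef1 /= => gf1.
by apply/unitrPr; exists (g 0); rewrite mulrC.
Qed.

Lemma fps_inv_out (R : comUnitRingType) :
  {in [predC @fps_unit R], @fps_inv R =1 id}.
Proof. by move=> f /negbTE nuf; rewrite /fps_inv nuf. Qed.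

HB.instance Definition _ (R : comUnitRingType) :=
  GRing.ComNzRing_hasMulInverse.Build (fps R)
    (@fps_mulVr R) (@fps_unitPl R) (@fps_inv_out R).

(* The variable t. *)
Definition fpsT (R : nzRingType) : fps R := Fps (fun n => (n == 1)%:R).

Definition fps_map (R S : Type) (phi : R -> S) (f : fps R) : fps S :=
  Fps (fun n => phi (f n)).

(* Composition f(g(t)). It is meaningful only when g has zero constant
   coefficient: g^i then does not contribute to t^n for i > n. *)
Definition fps_comp (R : comNzRingType) (f g : fps R) : fps R :=
  Fps (fun n => \sum_(i < n.+1) f i * (g ^+ i) n).

(* f / t, for f with zero constant coefficient (see [fps_divTK]). *)
Definition fps_divT (R : Type) (f : fps R) : fps R := Fps (fun n => f n.+1).

Lemma fps_divTK (R : comNzRingType) (f : fps R) :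
  f 0 = 0 -> fpsT R * fps_divT f = f.
Proof.
move=> f0; apply: fpsP => -[|n]; rewrite fps_coefM.
  by rewrite big_ord_recl big_ord0 /= mul0r addr0 f0.
rewrite !big_ord_recl /= mul0r add0r mul1r subSS subn0 big1 ?addr0 //.
by move=> i _; rewrite /= mul0r.
Qed.

Definition fps_exp (F : numFieldType) : fps F := Fps (fun n => (n`!%:R)^-1).

(* log(1+t); the constant coefficient is -1/0 = 0. *)
Definition fps_log1p (F : numFieldType) : fps F :=
  Fps (fun n => (-1) ^+ n.+1 / n%:R).

(* (1+t)^a = sum_n a(a-1)...(a-n+1)/n! t^n, for a in an F-algebra. *)
Definition fps_1pT_pow (F : numFieldType) (A : comUnitAlgType F) (a : A) :
    fps A :=
  Fps (fun n => (n`!%:R)^-1 *: \prod_(i < n) (a - i%:R)).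

Lemma fps_divT_log1p_unit (F : numFieldType) :
  fps_divT (fps_log1p F) \is a GRing.unit.
Proof.
by rewrite unfold_in /= /fps_unit /= expr2 mulN1r opprK divr1 unitr1.
Qed.

Lemma fps_1pT_pow_unit (F : numFieldType) (A : comUnitAlgType F) (a : A) :
  fps_1pT_pow a \is a GRing.unit.
Proof.
by rewrite unfold_in /= /fps_unit /= big_ord0 fact0 invr1 scale1r unitr1.
Qed.

Definition Lif (F : numFieldType) (k : int) : fps F :=
  Fps (fun n => (n`!%:R * (n.+1%:R : F) ^ k)^-1).

(* log(1+t) is not invertible as a power series: t / log(1+t) is the inverse
   of log(1+t) / t, whose constant coefficient is 1. *)
Definition fps_T_div_log1p (F : numFieldType) : fps F :=
  (fps_divT (fps_log1p F))^-1.

(* The generating function of the A_n^{(r,k)}(x), with x = 'X. *)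
Definition A_genfun (F : numFieldType) (r k : int) : fps {poly F} :=
  fps_map polyC (fps_T_div_log1p F ^ r * fps_comp (Lif F k) (fps_log1p F))
  / fps_1pT_pow ('X : {poly F}).

Definition A_poly (F : numFieldType) (r k : int) (n : nat) : {poly F} :=
  n`!%:R * A_genfun F r k n.

Definition stirling1 (F : numFieldType) (n m : nat) : F :=
  (\prod_(i < n) ('X - i%:R) : {poly F})`_m.

(* n! [t^n] (e^t - 1)^m / m!; this is 0 for n < m. *)
Definition stirling2 (F : numFieldType) (n m : nat) : F :=
  n`!%:R / m`!%:R * ((fps_exp F - 1) ^+ m) n.

(* Main.v *)
Require Import Defs.
From mathcomp Require Import all_boot all_order all_algebra.
From mathcomp Require Import ring zify.
From mathcomp Require Import reals complex.
Import GRing.Theory Num.Theory.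
Local Open Scope ring_scope.

(** Put [u = log(1+t)], so that [t = e^u - 1]. All three factors of the
    generating function are then power series in [u]: [(t/u)^r] has
    coefficients [r! S_2(s+r,r)/(s+r)!], [Lif_k(u)] is given, and
    [(1+t)^(-x) = e^(-xu)]. Multiplying them and expanding
    [u^m/m! = sum_n S_1(n,m) t^n/n!] gives the formula. *)

(** * Shift, derivative and composition of power series *)

Section FpsAlgebra.
Variable R : comNzRingType.
Implicit Types (f g h : fps R).

Lemma fps_coef_fpsTM0 f : (fpsT R * f) 0%N = 0.
Proof. by rewrite fps_coefM big_ord_recl big_ord0 /= mul0r addr0. Qed.

Lemma fps_coef_fpsTMS f n : (fpsT R * f) n.+1 = f n.
Proof.
rewrite fps_coefM !big_ord_recl /= mul0r add0r mul1r subSS subn0.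
by rewrite big1 ?addr0 // => i _; rewrite /= mul0r.
Qed.

Lemma fps_coef_fpsTXM f r n : (fpsT R ^+ r * f) (n + r)%N = f n.
Proof.
elim: r n => [|r IHr] n; first by rewrite mul1r addn0.
by rewrite exprS -mulrA addnS fps_coef_fpsTMS.
Qed.

(** Allows cancelling [t], which is not a unit in the ring of series. *)
Lemma fpsTM_inj : injective (fun f => fpsT R * f).
Proof.
move=> f g fg; apply: fpsP => n.
by rewrite -fps_coef_fpsTMS fg fps_coef_fpsTMS.
Qed.

Definition fps_deriv f : fps R := Fps (fun n => f n.+1 *+ n.+1).

(** A coefficient of a product depends only on truncations, so the product rule is inherited from
    polynomials. Truncation at [n.+2] keeps the coefficient [n.+1] that the derivative reads. *)
Lemma fps_derivM f g :
  fps_deriv (f * g) = fps_deriv f * g + f * fps_deriv g.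
Proof.
apply: fpsP => n; rewrite fps_coefD.
transitivity ((fps_trunc n.+2 f * fps_trunc n.+2 g)`_n.+1 *+ n.+1).
  by congr (_ *+ _); apply: fps_mul_trunc.
rewrite -coef_deriv derivM coefD !coefM !fps_coefM.
by congr (_ + _); apply: eq_bigr => i _; have := ltn_ord i;
  rewrite ?coef_deriv !coef_poly => lti; rewrite !ifT //; lia.
Qed.

Lemma fps_derivX f m : fps_deriv (f ^+ m.+1) = fps_deriv f * f ^+ m *+ m.+1.
Proof.
elim: m => [|m IHm]; first by rewrite mulr1.
rewrite exprS fps_derivM IHm [RHS]mulrS; congr (_ + _).
by rewrite exprS; ring.
Qed.

(** Since [h ^+ i] has no term below degree [i], the range may be enlarged at will; several
    coefficients can then share one range. *)
Lemma fps_comp_widen f h n N : h 0%N = 0 -> (n < N)%N ->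
  fps_comp f h n = \sum_(i < N) f i * (h ^+ i) n.
Proof.
move=> h0 ltnN; rewrite -(subnKC ltnN) big_split_ord /=.
rewrite [X in _ + X]big1 ?addr0 // => i _.
by rewrite fps_coef_exp_small ?mulr0 //= ltnS leq_addr.
Qed.

(* Modulo [t^(n+1)], [h^i] vanishes for [i > n], so both sides become finite
   double sums over [i, j <= n] with summand [f_i g_j h^(i+j)]. *)
Lemma fps_compM f g h : h 0%N = 0 ->
  fps_comp (f * g) h = fps_comp f h * fps_comp g h.
Proof.
move=> h0; apply: fpsP => n.
pose C (c : R) : fps R := Fps (fun n => if n == 0%N then c else 0).
have CM c (w : fps R) q : (C c * w) q = c * w q.
  rewrite fps_coefM big_ord_recl /= subn0 big1 ?addr0 // => i _.
  by rewrite /= mul0r.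
(* Truncating before composing gives a genuine finite sum of series, to which distributivity
   applies. *)
pose S N f := \sum_(i < N) C (f i) * h ^+ i.
have SE N (w : fps R) q : (q < N)%N -> S N w q = fps_comp w h q.
  move=> ltqN; rewrite (fps_comp_widen _ _ _ _ h0 ltqN) /S fps_coef_sum.
  by apply: eq_bigr => i _; rewrite CM.
have -> : (fps_comp f h * fps_comp g h) n = (S n.+1 f * S n.+1 g) n.
  rewrite !fps_coefM; apply: eq_bigr => i _.
  by rewrite !SE // ltnS leq_subr.
rewrite /S big_distrlr /= fps_coef_sum.
transitivity (\sum_(i < n.+1) \sum_(j < n.+1)
    (f i * g j) * (h ^+ (i + j)) n); last first.
  apply: eq_bigr => i _; rewrite fps_coef_sum; apply: eq_bigr => j _.
  by rewrite [in RHS]mulrACA -exprD -[in RHS]mulrA !CM mulrA.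
(* On the left [j] is the total exponent, hence [i <= j]. The inner sums then differ by the shift of
   [j] by [i], up to terms of exponent above [n], which vanish. *)
transitivity (\sum_(i < n.+1) \sum_(j < n.+1 | (i <= j)%N)
    (f i * g (j - i)%N) * (h ^+ j) n).
  rewrite /fps_comp /= (exchange_big_dep xpredT) //=.
  apply: eq_bigr => j _; rewrite mulr_suml.
  by rewrite (big_ord_widen_cond n.+1 xpredT
    (fun i => f i * g (j - i)%N * (h ^+ j) n)).
apply: eq_bigr => i _.
have lein : (i <= n)%N by rewrite -ltnS.
rewrite -(big_mkord (fun j => i <= j)%N
  (fun j => f i * g (j - i)%N * (h ^+ j) n)).
rewrite -(big_mkord xpredT (fun j => f i * g j * (h ^+ (i + j)) n)).
rewrite [RHS](big_cat_nat (n := (n.+1 - i)%N)) ?leq_subr //=.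
rewrite [X in _ = _ + X]big_nat [X in _ = _ + X]big1 ?addr0; last first.
  move=> j /andP[lej _]; rewrite fps_coef_exp_small ?mulr0 //; lia.
rewrite (big_cat_nat (n := i)) //=; last exact: leqW.
rewrite big_nat_cond big1 ?add0r; last by move=> j; lia.
rewrite -{1}[i : nat]add0n big_addn big_nat_cond [RHS]big_nat_cond.
apply: eq_big => [j|j _]; first by lia.
by rewrite addnK addnC.
Qed.

Lemma fps_comp1 h : fps_comp 1 h = 1.
Proof.
apply: fpsP => n; rewrite /= big_ord_recl /= mul1r big1 ?addr0 // => i _.
by rewrite /= mul0r.
Qed.

Lemma fps_compX f h m : h 0%N = 0 -> fps_comp (f ^+ m) h = fps_comp f h ^+ m.
Proof.
move=> h0; elim: m => [|m IHm]; first exact: fps_comp1.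
by rewrite !exprS fps_compM // IHm.
Qed.

Lemma fps_compB f g h : fps_comp (f - g) h = fps_comp f h - fps_comp g h.
Proof.
apply: fpsP => n; rewrite fps_coefD fps_coefN /= -sumrB.
by apply: eq_bigr => i _; rewrite mulrBl.
Qed.

Lemma fps_comp_fpsT h : h 0%N = 0 -> fps_comp (fpsT R) h = h.
Proof.
move=> h0; apply: fpsP => n; rewrite (@fps_comp_widen _ _ _ n.+2) //.
rewrite !big_ord_recl /= mul0r add0r mul1r big1 ?addr0 // => i _.
by rewrite /= mul0r.
Qed.

End FpsAlgebra.

(** * Change of coefficient ring *)

Section FpsMap.
Variables (R S : comNzRingType) (phi : {rmorphism R -> S}).

Lemma fps_mapM (f g : fps R) :
  fps_map phi (f * g) = fps_map phi f * fps_map phi g.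
Proof.
apply: fpsP => n; rewrite fps_coefM /= rmorph_sum.
by apply: eq_bigr => i _; rewrite rmorphM.
Qed.

Lemma fps_map1 : fps_map phi 1 = 1.
Proof. by apply: fpsP => n; rewrite /= rmorph_nat. Qed.

Lemma fps_mapX (f : fps R) m : fps_map phi (f ^+ m) = fps_map phi f ^+ m.
Proof.
by elim: m => [|m IHm]; rewrite ?fps_map1 // !exprS fps_mapM IHm.
Qed.

Lemma fps_map_comp (f g : fps R) :
  fps_map phi (fps_comp f g) = fps_comp (fps_map phi f) (fps_map phi g).
Proof.
apply: fpsP => n /=; rewrite rmorph_sum; apply: eq_bigr => i _.
by rewrite rmorphM -fps_mapX.
Qed.

End FpsMap.

(** * Powers of [log(1+t)] and Stirling numbers of the first kind *)

Section Log1p.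
Variable F : numFieldType.
Implicit Types (n m r : nat).

Let fact_neq0 n : n`!%:R != 0 :> F.
Proof. by rewrite pnatr_eq0 -lt0n fact_gt0. Qed.

Lemma fps_log1p_coef0 : fps_log1p F 0%N = 0.
Proof. by rewrite /= invr0 mulr0. Qed.

Lemma fps_deriv_log1p : (1 + fpsT F) * fps_deriv _ (fps_log1p F) = 1.
Proof.
(* An alternating geometric series, so multiplication by [1+t] telescopes. *)
have D n : fps_deriv _ (fps_log1p F) n = (-1) ^+ n.
  rewrite /= -[LHS]mulr_natr divfK ?pnatr_eq0 // !exprS; ring.
apply: fpsP => -[|n]; rewrite mulrDl mul1r fps_coefD.
  by rewrite fps_coef_fpsTM0 D addr0.
by rewrite fps_coef_fpsTMS !D exprS mulN1r addNr.
Qed.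

(** Compare coefficients of [t^n] in [(1+t) (u^(m+1))' = (m+1) u^m], which follows from
    [(1+t) u' = 1]. *)
Lemma fps_log1pX_recS m n :
  (fps_log1p F ^+ m.+1) n.+1 * n.+1%:R + (fps_log1p F ^+ m.+1) n * n%:R
  = (fps_log1p F ^+ m) n * m.+1%:R.
Proof.
set u := fps_log1p F.
have /(congr1 (fun f : fps F => f n)) :
    (1 + fpsT F) * fps_deriv _ (u ^+ m.+1) = u ^+ m * m.+1%:R.
  by rewrite fps_derivX mulrnAr mulrA fps_deriv_log1p mul1r mulr_natr.
have -> : (u ^+ m * m.+1%:R) n = (u ^+ m) n * m.+1%:R.
  rewrite !mulr_natr; elim: (m.+1) => [|q IHq] //.
  by rewrite !mulrS fps_coefD IHq.
rewrite mulrDl mul1r fps_coefD => <-; congr (_ + _).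
  by rewrite /= mulr_natr.
case: n => [|n]; first by rewrite fps_coef_fpsTM0 mulr0.
by rewrite fps_coef_fpsTMS /= mulr_natr.
Qed.

Lemma stirling1S0 n : stirling1 F n.+1 0 = - (stirling1 F n 0 * n%:R).
Proof.
rewrite /stirling1 big_ord_recr /= mulrBr coefB coefMX sub0r.
by rewrite -[n%:R]polyC_natr coefMC.
Qed.

Lemma stirling1SS n m :
  stirling1 F n.+1 m.+1 = stirling1 F n m - stirling1 F n m.+1 * n%:R.
Proof.
rewrite /stirling1 big_ord_recr /= mulrBr coefB coefMX.
by rewrite -[n%:R]polyC_natr coefMC.
Qed.

(** Induction on [n]: after scaling by factorials, the recurrence from the differential equation is
    that of the Stirling numbers. *)
Lemma fps_log1pX_coef n m :
  n`!%:R * (fps_log1p F ^+ m) n = m`!%:R * stirling1 F n m.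
Proof.
elim: n m => [|n IHn] [|m].
- by rewrite /stirling1 big_ord0 coef1.
- rewrite fps_coef_exp_small ?fps_log1p_coef0 //.
  by rewrite /stirling1 big_ord0 coef1 !mulr0.
- rewrite stirling1S0 mulrN mulrA -IHn.
  by case: n {IHn} => [|n]; rewrite !expr0 !fps_coef1 !(mulr0, mul0r) oppr0.
- rewrite stirling1SS mulrBr [X in _ - X]mulrA -IHn.
  rewrite factS natrM (mulrC _ n`!%:R) factS natrM -[m.+1%:R * _ * _]mulrA.
  rewrite -IHn -mulrA (mulrC n.+1%:R).
  have /(canRL (addrK _)) -> := fps_log1pX_recS m n.
  by ring.
Qed.

Lemma falling_poly_stirling1 n :
  \prod_(i < n) ('X - i%:R) =
  \sum_(m < n.+1) stirling1 F n m *: 'X^m :> {poly F}.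
Proof.
(* The coefficients agree by definition of [stirling1]; only the degree needs an argument. *)
rewrite -[LHS]coefK poly_def.
have -> : size (\prod_(i < n) ('X - i%:R) : {poly F}) = n.+1.
  under eq_bigr do rewrite -polyC_natr.
  by rewrite size_prod_XsubC /index_enum -enumT size_enum_ord.
by [].
Qed.

(** * The exponential [e^(a t)] with polynomial [a], and [(1+t)^x] *)

Definition fps_expZ (a : {poly F}) : fps {poly F} :=
  Fps (fun n => (n`!%:R)^-1 *: a ^+ n).

(** Coefficientwise, the binomial theorem divided by [n!]. *)
Lemma fps_expZD a b : fps_expZ (a + b) = fps_expZ a * fps_expZ b.
Proof.
apply: fpsP => n; rewrite fps_coefM /= addrC exprDn scaler_sumr.
apply: eq_bigr => i _.
have lein : (i <= n)%N by rewrite -ltnS.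
rewrite -scalerAl -scalerAr scalerA -mulr_natl mulrnAl mul1r -scaler_nat.
rewrite scalerA mulrC; congr (_ *: _); last by rewrite mulrC.
rewrite -(bin_fact lein) !natrM; field.
by rewrite !fact_neq0 pnatr_eq0 -lt0n bin_gt0 lein.
Qed.

Lemma fps_expZ0 : fps_expZ 0 = 1.
Proof.
apply: fpsP => -[|n] /=; first by rewrite fact0 invr1 scale1r.
by rewrite expr0n scaler0.
Qed.

Let U := fps_map (@polyC F) (fps_log1p F).

Let U0 : U 0%N = 0.
Proof. by rewrite /= invr0 mulr0. Qed.

(** Both sides have [t^n] coefficient [sum_m S_1(n,m) x^m / n!]: on the left by expanding the
    falling factorial, on the right by expanding [u^m / m!]. *)
Lemma fps_1pT_powXE : fps_1pT_pow ('X : {poly F}) = fps_comp (fps_expZ 'X) U.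
Proof.
apply: fpsP => n /=; rewrite falling_poly_stirling1 scaler_sumr.
apply: eq_bigr => m _.
rewrite -fps_mapX /= mulrC mul_polyC !scalerA; congr (_ *: _).
apply: (mulfI (fact_neq0 n)); rewrite mulVKf // mulrA fps_log1pX_coef.
by rewrite mulrAC divff // mul1r.
Qed.

Lemma fps_1pT_powXV :
  (fps_1pT_pow ('X : {poly F}))^-1 = fps_comp (fps_expZ (- 'X)) U.
Proof.
apply: (mulrI (fps_1pT_pow_unit ('X : {poly F}))).
rewrite mulrV ?fps_1pT_pow_unit // fps_1pT_powXE -fps_compM //.
by rewrite -fps_expZD subrr fps_expZ0 fps_comp1.
Qed.

(** * The factor [t / log(1+t)] and Stirling numbers of the second kind *)

Lemma fps_exp_comp_log1p : fps_comp (fps_exp F) (fps_log1p F) = 1 + fpsT F.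
Proof.
apply: fpsP => n; rewrite fps_coefD fps_coef1 /=.
(* The sum is a falling factorial at [x = 1], which vanishes for [n >= 2] because of its factor
   [1 - 1]. *)
have -> : \sum_(m < n.+1) (m`!%:R)^-1 * (fps_log1p F ^+ m) n =
          (n`!%:R)^-1 * (\prod_(i < n) ('X - i%:R) : {poly F}).[1].
  rewrite falling_poly_stirling1 horner_sum mulr_sumr.
  apply: eq_bigr => m _; rewrite hornerZ hornerXn expr1n mulr1.
  apply: (mulfI (fact_neq0 n)); rewrite mulVKf // mulrCA fps_log1pX_coef.
  by rewrite mulKf.
rewrite horner_prod; case: n => [|[|n]].
- by rewrite big_ord0 fact0 invr1 mulr1 addr0.
- by rewrite big_ord1 /= subr0 hornerX invr1 mulr1 add0r.
- by rewrite !big_ord_recl /= !hornerE subrr /= mulr0 mul0r.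
Qed.

(** Multiplying by [u/t] and then by [t] reduces the claim to [e^s - 1 = s ((e^s - 1)/s)] at
    [s = u], where the left side is [t]. *)
Lemma fps_T_div_log1pE :
  fps_T_div_log1p F = fps_comp (fps_divT (fps_exp F - 1)) (fps_log1p F).
Proof.
have u0 := fps_log1p_coef0.
apply: (mulrI (fps_divT_log1p_unit F)).
rewrite mulrV ?fps_divT_log1p_unit //; apply: fpsTM_inj.
rewrite mulr1 mulrA fps_divTK //.
rewrite -[X in X * fps_comp _ _](fps_comp_fpsT _ _ u0).
rewrite -fps_compM // fps_divTK; last first.
  by rewrite fps_coefD fps_coefN fps_coef1 /= fact0 invr1 subrr.
by rewrite fps_compB fps_exp_comp_log1p fps_comp1 addrAC subrr add0r.
Qed.

(** Multiplication by [t^r] turns the series into [(e^t - 1)^r] and moves index [s] to [s + r]. *)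
Lemma fps_divT_exp1X_coef r s :
  (fps_divT (fps_exp F - 1) ^+ r) s =
  r`!%:R / (s + r)`!%:R * stirling2 F (s + r) r.
Proof.
rewrite -(fps_coef_fpsTXM _ _ r) -exprMn fps_divTK; last first.
  by rewrite fps_coefD fps_coefN fps_coef1 /= fact0 invr1 subrr.
by rewrite /stirling2; field; rewrite !fact_neq0.
Qed.

(** * Extraction of the coefficients of the generating function *)

Lemma natr_bin n m : (m <= n)%N ->
  'C(n, m)%:R = n`!%:R / (m`!%:R * (n - m)`!%:R) :> F.
Proof.
by move=> /bin_fact <-; rewrite -natrM natrM mulfK // natrM mulf_neq0.
Qed.

Lemma A_poly_stirling n r (k : int) :
  A_poly F r%:Z k n =
  \sum_(0 <= j < n.+1)
    (\sum_(j <= m < n.+1) \sum_(0 <= l < (m - j).+1)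
        ('C(m, l)%:R * 'C(m - l, j)%:R)
        / ('C(m - l - j + r, r)%:R * (l.+1%:R : F) ^ k)
        * stirling1 F n m * stirling2 F (m - l - j + r) r)
    *: (- 'X : {poly F}) ^+ j.
Proof.
have u0 := fps_log1p_coef0.
rewrite /A_poly /A_genfun -exprnP fps_T_div_log1pE -fps_compX // -fps_compM //.
(* [P] collects the two factors free of [x], as a series in [u]. *)
set P := _ * Lif F k.
rewrite fps_1pT_powXV fps_map_comp -/U -fps_compM //.
transitivity (\sum_(m < n.+1)
    n`!%:R * ((fps_map polyC P * fps_expZ (- 'X)) m * (U ^+ m) n)).
  by rewrite -mulr_sumr.
rewrite [RHS]big_mkord.
under [RHS]eq_bigr do rewrite big_geq_mkord scaler_suml.
(* The power [m] of [u] becomes the outer index; [j <= m] stays as a condition inside. *)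
rewrite (exchange_big_dep xpredT) //; apply: eq_bigr => m _.
have -> : (U ^+ m) n = ((fps_log1p F ^+ m) n)%:P by rewrite -fps_mapX.
rewrite mulrCA -polyC_natr -polyCM fps_log1pX_coef mulrC mul_polyC.
rewrite [fps_map _ P * _]mulrC fps_coefM scaler_sumr.
rewrite (big_ord_widen_cond n.+1 xpredT (fun i => (m`!%:R * stirling1 F n m) *:
   (fps_expZ (- 'X) i * fps_map polyC P (m - i)%N))) //.
apply: eq_big => [j|j lejm]; first by rewrite ltnS.
move: lejm => /= lejm.
rewrite /= [_ * (P _)%:P]mulrC mul_polyC !scalerA; congr (_ *: _).
(* With the [Lif] factor first, [l] is its degree and [m - j - l] is left for [(t/u)^r]. *)
rewrite /P mulrC (mulrC _ (Lif F k)) fps_coefM !mulr_sumr big_mkord.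
apply: eq_bigr => l _.
have lel : (l <= m - j)%N by rewrite -ltnS.
rewrite fps_divT_exp1X_coef subnAC /=.
(* In factorials, [(m-l-j)!] cancels between the binomials, leaving [m! r! / (l! j! (m-l-j+r)!)]. *)
rewrite !natr_bin ?leq_addl ?addnK //; try lia.
have kn0 : (l.+1%:R : F) ^ k != 0 by rewrite expfz_neq0 // pnatr_eq0.
by field; rewrite !fact_neq0 kn0.
Qed.

End Log1p.

Theorem theorem2p1 (R : realType) (n r : nat) (k : int) :
  A_poly R[i] r%:Z k n =
  \sum_(0 <= j < n.+1)
    (\sum_(j <= m < n.+1) \sum_(0 <= l < (m - j).+1)
        ('C(m, l)%:R * 'C(m - l, j)%:R)
        / ('C(m - l - j + r, r)%:R * (l.+1%:R : R[i]) ^ k)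
        * stirling1 R[i] n m * stirling2 R[i] (m - l - j + r) r)
    *: (- 'X : {poly R[i]}) ^+ j.
Proof. exact: A_poly_stirling. Qed.
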